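(* Let $X$ be a smooth complex Banach space and let $T \in B(X)$ be a compact self-adjoint operator. Then there exists a finite or infinite sequence $(\lambda_n)_{n=1}^N$, $N \in \mathbb{N}\cup\{\infty\}$, of distinct nonzero real eigenvalues of $T$ such that $$T = \sum_{n=1}^N \lambda_n P_n,$$ where, for each $n$, $P_n$ is a natural projection of $X$ onto $\ker(T-\lambda_n I)$ (the convergence of the series when $N=\infty$ being in the operator norm). Moreover, if $N=\infty$, then $\lambda_n \to 0$ as $n\to\infty$.
   Context: $X$ is a complex Banach space, $X^*$ its dual, $B(X)$ the algebra of bounded linear operators on $X$, $S_X$ the unit sphere. $X$ is smooth if for every $x\in S_X$ there is a unique $x^*\in S_{X^*}$ with $x^*(x)=1$. The duality mapping $J:X\to X^*$ of a smooth space sends $x\in S_X$ to this unique $x^*$; for general $x\in X$, $J(x)$ is the unique functional with $\|J(x)\|=\|x\|$ and $J(x)(x)=\|x\|^2$ (so $J(0)=0$). $J$ need not be additive. The transpose of $T\in B(X)$ is the operator $T'$ on $X^*$ given by $(T'y)(x)=y(Tx)$. An operator $T\in B(X)$ is called self-adjoint if $T'\circ J=J\circ T$, i.e. $J(x)(Tv)=J(Tx)(v)$ for all $x,v\in X$. Natural projection: if $V_1$ is a finite-dimensional subspace of $X$, there exists a closed subspace $V_2$ of $X$ with $X=V_1\oplus V_2$; writing each $x\in X$ uniquely as $x=v_1+v_2$ with $v_1\in V_1$, $v_2\in V_2$, the operator $P\in B(X)$, $P(x)=v_1$, is called a natural projection onto $V_1$ (i.e. a bounded linear projection with range $V_1$,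 for some closed complement $V_2$). Convention: when $T=0$ the sequence of eigenvalues is empty ($N=0$) and the sum is $0$. *)

(* Defs.v *)
From HB Require Import structures.
From mathcomp Require Import all_boot all_order all_algebra complex.
From mathcomp Require Import all_classical all_reals all_analysis.
Set Implicit Arguments.
Unset Strict Implicit.
Unset Printing Implicit Defensive.
Import Order.TTheory GRing.Theory Num.Theory.
Import numFieldNormedType.Exports.
Local Open Scope classical_set_scope.
Local Open Scope complex_scope.
Local Open Scope ring_scope.

(* A complex Banach space is a [completeNormedModType R[i]]; its norm takes
   values in R[i], and these values are nonnegative, hence real. *)

Definition unit_ball (R : realType) (X : normedModType R[i]) : set X :=
  [set x | `|x| <= 1].
Arguments unit_ball {R} X.

(* Meaningful only for bounded linear maps, because [sup] returns 0 on a set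
   that is not bounded above. *)
Definition opnorm (R : realType) (X Y : normedModType R[i]) (f : X -> Y) : R :=
  sup [set complex.Re `|f x| | x in unit_ball X].

(* For linear maps continuity is boundedness, see [linear_bounded_continuous]. *)
Definition continuous_dual (R : realType) (X : normedModType R[i]) :
    set (X -> R[i]^o) :=
  [set f : X -> R[i]^o | linear f /\ continuous f].
Arguments continuous_dual {R} X.

Definition smooth (R : realType) (X : normedModType R[i]) : Prop :=
  forall x : X, `|x| = 1 ->
    exists! f : X -> R[i]^o, [/\ continuous_dual X f, opnorm f = 1 & f x = 1].

(* The default value 0 of [xget] is never reached when X is smooth: exactly one
   functional then satisfies the defining condition. *)
Definition duality (R : realType) (X : normedModType R[i]) (x : X) :
    X -> R[i]^o :=
  xget (cst 0)
    [set f : X -> R[i]^o |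
      [/\ continuous_dual X f, (opnorm f)%:C = `|x| & f x = `|x| ^+ 2]].

Definition transpose (R : realType) (X : normedModType R[i]) (T : X -> X)
    (y : X -> R[i]^o) : X -> R[i]^o :=
  y \o T.

Definition self_adjoint (R : realType) (X : normedModType R[i])
    (T : X -> X) : Prop :=
  transpose T \o @duality R X = @duality R X \o T.

Definition compact_operator (R : realType) (X : normedModType R[i])
    (T : X -> X) : Prop :=
  precompact (T @` unit_ball X).

Definition ker_sub (R : realType) (X : normedModType R[i]) (T : X -> X)
    (a : R[i]) : set X :=
  [set x | T x - a *: x = 0].

Definition is_eigenvalue (R : realType) (X : normedModType R[i]) (T : X -> X)
    (a : R[i]) : Prop :=
  exists2 x : X, x != 0 & T x = a *: x.

Definition finite_dimensional (R : realType) (X : normedModType R[i])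
    (V : set X) : Prop :=
  exists (k : nat) (e : 'I_k -> X),
    V = range (fun c : 'I_k -> R[i] => \sum_(i < k) c i *: e i).

Definition direct_sum (R : realType) (X : normedModType R[i])
    (V1 V2 : set X) : Prop :=
  forall x : X, exists! v : X * X, [/\ V1 v.1, V2 v.2 & x = v.1 + v.2].

Definition natural_projection (R : realType) (X : normedModType R[i])
    (V1 : set X) (P : {linear X -> X}) : Prop :=
  [/\ finite_dimensional V1, continuous P &
      exists V2 : set X,
        [/\ submod_closed [in V2], closed V2, direct_sum V1 V2 &
            forall v1 v2, V1 v1 -> V2 v2 -> P (v1 + v2) = v1]].

(* A length in N u {oo} is encoded by [option nat], [None] being oo; the
   sequences (lambda_n) and (P_n) are indexed from 0 and only their values at
   the indices satisfying [below N] matter. *)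
Definition below (N : option nat) (n : nat) : bool :=
  if N is Some k then (n < k)%N else true.

Definition partial_sum (R : realType) (X : normedModType R[i])
    (lambda : nat -> R) (P : nat -> {linear X -> X}) (k : nat) : X -> X :=
  fun x => \sum_(n < k) (lambda n)%:C *: P n x.

(* Main.v *)
Require Import Defs.
From HB Require Import structures.
From mathcomp Require Import all_boot all_order all_algebra complex.
From mathcomp Require Import all_classical all_reals all_analysis.
From mathcomp Require Import lra.
Import Order.TTheory GRing.Theory Num.Theory.
Import numFieldNormedType.Exports.
Local Open Scope classical_set_scope.
Local Open Scope complex_scope.
Local Open Scope ring_scope.

Set Implicit Arguments.
Unset Strict Implicit.
Unset Printing Implicit Defensive.

(** The proof avoids Riesz and Fredholm theory: compactness enters only through
    cluster points of sequences, and the duality mapping [J], behaving like a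
    semi-inner product [J x v], supplies every projection that is needed.

    Self-adjointness gives [J x (T v) = l J x v] for an eigenvector [x] with
    real eigenvalue [l]; hence [J x] vanishes on the other eigenvectors and its
    kernel is invariant under [T].  It also gives
    [|T x| ^ 2 = J (T x) (T x) = J x (T (T x)) <= |x| |T (T x)|], so on a closed
    invariant subspace [M] a compact [T] attains its norm [S], at some [p]
    with [|T (T p)| = S ^ 2 |p|].  Uniqueness of duality functionals then makes
    [J p] invariant under [A = (T / S) ^ 2]: the Cesaro means of the [A ^ k p]
    stay on the hyperplane [J p = S ^ 2] and cluster at a nonzero fixed point of
    [A].  So [S] or [- S] is an eigenvalue ([extremal_eigenvalue]).

    For [l != 0], unit eigenvectors [x_1, x_2, ...] chosen with [J x_i x_j = 0]
    for [i < j] have [|l|]-separated images under [T], so there are finitely many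
    of them, and deflating along them gives a bounded projection onto
    [ker (T - l)] that commutes with [T] ([spectral_projection]).  Applying
    [extremal_eigenvalue] repeatedly to the common kernel of the projections
    already found enumerates the nonzero eigenvalues by decreasing modulus;
    compactness forces them to tend to [0].

    If [Q_n] is the sum of the first [n] projections, [T] is bounded by
    [|lam_n|] on the range of [1 - Q_n], so norm convergence only needs a uniform
    bound on the [Q_n].  Where the modulus drops strictly, pulling [J (Q_n v)]
    back along [T ^ m] shows that it kills the remainder [v - Q_n v]
    ([J_decay]), so that [|Q_n v| <= |v|].  The modulus fails to drop only inside
    a pair [l, - l], where [Q_n] is such a contraction minus a single spectral
    projection, itself a contraction for the same reason ([leading_le]). *)

(** * Real-valued norms *)

(** The norm of a space over [R[i]] takes its values in [R[i]], only partially
    ordered; its real part carries the same information in an ordered field. *)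
Definition nrm (R : realType) (V : normedZmodType R[i]) (x : V) : R :=
  complex.Re `|x|.

Section RealNorm.
Variable R : realType.

Section Zmod.
Variable V : normedZmodType R[i].
Implicit Types x y : V.

Lemma nrmE x : `|x| = (nrm x)%:C.
Proof. by rewrite RRe_real ?normr_real. Qed.

Lemma nrm_le_lec x (c : R) : (`|x| <= c%:C) = (nrm x <= c).
Proof. by rewrite nrmE lecR. Qed.

Lemma nrm_ge0 x : 0 <= nrm x.
Proof. by rewrite -ler0c -nrmE normr_ge0. Qed.

Lemma nrm_eq0 x : (nrm x == 0) = (x == 0).
Proof. by rewrite -[RHS]normr_eq0 nrmE -(inj_eq (@complexI R)). Qed.

Lemma nrm0 : nrm (0 : V) = 0.
Proof. by apply/eqP; rewrite nrm_eq0. Qed.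

Lemma nrm_gt0 x : (0 < nrm x) = (x != 0).
Proof. by rewrite lt0r nrm_eq0 nrm_ge0 andbT. Qed.

Lemma nrmN x : nrm (- x) = nrm x.
Proof. by rewrite /nrm normrN. Qed.

Lemma nrm_distC x y : nrm (x - y) = nrm (y - x).
Proof. by rewrite /nrm distrC. Qed.

Lemma ler_nrmD x y : nrm (x + y) <= nrm x + nrm y.
Proof. by rewrite -lecR rmorphD /= -!nrmE ler_normD. Qed.

Lemma ler_nrmB x y : nrm (x - y) <= nrm x + nrm y.
Proof. by rewrite -(nrmN y) ler_nrmD. Qed.

Lemma ler_nrm_sum (I : Type) (s : seq I) (D : pred I) (F : I -> V) :
  nrm (\sum_(i <- s | D i) F i) <= \sum_(i <- s | D i) nrm (F i).
Proof.
elim/big_rec2: _ => [|i c x _ IH]; first by rewrite nrm0.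
by rewrite (le_trans (ler_nrmD _ _))// lerD2l.
Qed.

End Zmod.

Lemma nrmM (a b : R[i]) : nrm (a * b) = nrm a * nrm b.
Proof. by apply: complexI; rewrite rmorphM /= -!nrmE normrM. Qed.

Lemma nrmC (c : R) : nrm (c%:C : R[i]) = `|c|.
Proof. by rewrite /nrm normc_def /= expr0n /= addr0 sqrtr_sqr. Qed.

Lemma nrmZ (V : normedModType R[i]) (a : R[i]) (x : V) :
  nrm (a *: x) = nrm a * nrm x.
Proof. by apply: complexI; rewrite rmorphM /= -!nrmE normrZ. Qed.

Lemma nrmZC (V : normedModType R[i]) (c : R) (x : V) :
  nrm (c%:C *: x) = `|c| * nrm x.
Proof. by rewrite nrmZ nrmC. Qed.

End RealNorm.

(** * Bounded linear maps *)

Section BoundedMaps.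
Variable R : realType.

Lemma opnorm_le (X Y : normedModType R[i]) (f : X -> Y) (c : R) :
  0 <= c -> (forall v, nrm (f v) <= c * nrm v) -> opnorm f <= c.
Proof.
move=> c0 fc; apply: ge_sup.
  by exists (nrm (f 0)); exists 0 => //=; rewrite /unit_ball/= normr0.
move=> _ [x xB <-]; apply: (le_trans (fc x)); rewrite ler_piMr//.
by rewrite -nrm_le_lec.
Qed.

Lemma opnorm_ge0 (X Y : normedModType R[i]) (f : X -> Y) (c : R) :
  0 <= c -> (forall v, nrm (f v) <= c * nrm v) -> 0 <= opnorm f.
Proof.
move=> c0 fc; apply: (@le_trans _ _ (nrm (f 0))); first exact: nrm_ge0.
apply: sup_ubound; last by exists 0 => //=; rewrite /unit_ball/= normr0.
exists c => _ [x xB <-]; apply: (le_trans (fc x)); rewrite ler_piMr//.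
by rewrite -nrm_le_lec.
Qed.

(** The supremum defining the operator norm is a genuine bound as soon as some
    bound exists; homogeneity carries it from the unit ball to all vectors. *)
Lemma nrm_le_opnorm (X Y : normedModType R[i]) (f : {linear X -> Y}) (c : R) :
  (forall v, nrm (f v) <= c * nrm v) ->
  forall v, nrm (f v) <= opnorm f * nrm v.
Proof.
move=> fc v; have [->|v0] := eqVneq v 0; first by rewrite linear0 !nrm0 mulr0.
have nv : 0 < nrm v by rewrite nrm_gt0.
rewrite -ler_pdivrMr//.
have -> : nrm (f v) / nrm v = nrm (f ((nrm v)^-1%:C *: v)).
  by rewrite linearZ /= nrmZC ger0_norm ?invr_ge0 ?nrm_ge0// mulrC.
apply: sup_ubound; last first.
  exists ((nrm v)^-1%:C *: v) => //=; rewrite /unit_ball /= (nrm_le_lec _ 1).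
  by rewrite nrmZC ger0_norm ?invr_ge0 ?nrm_ge0// mulVf// gt_eqF.
exists `|c| => _ [x xB <-]; apply: (le_trans (fc x)).
have x1 : nrm x <= 1 by rewrite -nrm_le_lec.
apply: (@le_trans _ _ (`|c| * nrm x)).
  by rewrite ler_wpM2r ?nrm_ge0// ler_norm.
by rewrite ler_piMr.
Qed.

Lemma bounded_continuous (X Y : normedModType R[i]) (f : {linear X -> Y})
    (c : R) :
  (forall v, nrm (f v) <= c * nrm v) -> continuous f.
Proof.
move=> fc; apply: bounded_linear_continuous; apply/bounded_funP => r.
exists (`|c|%:C * r) => x xr; apply: (@le_trans _ _ (`|c|%:C * `|x|)).
  rewrite (nrmE (f x)) (nrmE x) -rmorphM lecR (le_trans (fc x))//.
  by rewrite ler_wpM2r ?nrm_ge0// ler_norm.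
by rewrite ler_wpM2l// lecR.
Qed.

Lemma continuous_bounded (X Y : normedModType R[i]) (f : {linear X -> Y}) :
  continuous f -> exists2 c : R, 0 <= c & forall v, nrm (f v) <= c * nrm v.
Proof.
move=> /linear_bounded_continuous/bounded_funP/(_ 1)[M fM].
exists (complex.Re M) => [|v].
  apply: (@le_trans _ _ (nrm (f 0))); first exact: nrm_ge0.
  have := fM 0; rewrite normr0 => /(_ ler01); rewrite nrmE lecE /=.
  by case/andP.
have [->|v0] := eqVneq v 0; first by rewrite linear0 !nrm0 mulr0.
have nv : 0 < nrm v by rewrite nrm_gt0.
have := fM ((nrm v)^-1%:C *: v); rewrite (nrm_le_lec _ 1) nrmZC.
rewrite ger0_norm ?invr_ge0 ?nrm_ge0// mulVf ?gt_eqF// => /(_ (lexx _)).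
rewrite nrmE lecE /= => /andP[_]; rewrite linearZ /= nrmZC.
by rewrite ger0_norm ?invr_ge0 ?nrm_ge0// mulrC ler_pdivrMr.
Qed.

Lemma closed_approx (X : normedModType R[i]) (M : set X) (p : X) : closed M ->
  (forall e : R, 0 < e -> exists2 v, M v & nrm (p - v) < e) -> M p.
Proof.
move=> clM appr; apply: clM => A /nbhs_normP[/= e e0 eA].
have e0' : 0 < complex.Re e by move: e0; rewrite ltcE => /andP[].
have [v Mv pv] := appr _ e0'; exists v; split=> //; apply: eA => /=.
by rewrite nrmE ltcE /= pv andbT; move: e0; rewrite ltcE /= => /andP[].
Qed.

Lemma closed_kernel (X Y : normedModType R[i]) (f : {linear X -> Y}) (c : R) :
  (forall v, nrm (f v) <= c * nrm v) -> closed [set v | f v = 0].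
Proof.
move=> fc; apply: (@closed_comp _ _ f [set 0]).
  by move=> v _; apply: (bounded_continuous fc).
exact: accessible_closed_set1 (hausdorff_accessible (@norm_hausdorff _ _)) _.
Qed.

End BoundedMaps.

(** * The duality mapping of a smooth space *)

Section Duality.
Variables (R : realType) (X : normedModType R[i]).
Implicit Types (x v : X) (f g : X -> R[i]^o).

(** The description of the duality functional through a pointwise bound; it is
    equivalent to the one through the operator norm, as the bound is attained
    at [x]. *)
Definition norming x f : Prop :=
  [/\ linear f, forall v, nrm (f v) <= nrm x * nrm v & f x = (nrm x ^+ 2)%:C].

Lemma norming_opnorm x f : norming x f -> opnorm f = nrm x.
Proof.
move=> [fl fB fx]; apply/eqP; rewrite eq_le opnorm_le ?nrm_ge0//=.
have [->|x0] := eqVneq x 0; first by rewrite nrm0 (opnorm_ge0 (nrm_ge0 x) fB).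
have nx : 0 < nrm x by rewrite nrm_gt0.
pose F : {linear X -> R[i]^o} := HB.pack f (GRing.isLinear.Build _ _ _ _ f fl).
have := @nrm_le_opnorm _ _ _ F _ fB x.
by rewrite /F /= fx nrmC ger0_norm ?sqr_ge0// expr2 ler_pM2r.
Qed.

Lemma norming_dualP x f :
  norming x f <->
  [/\ continuous_dual X f, (opnorm f)%:C = `|x| & f x = `|x| ^+ 2].
Proof.
have sqrE : `|x| ^+ 2 = (nrm x ^+ 2)%:C by rewrite nrmE rmorphXn.
split=> [nf|[[fl fc] fn fx]].
  have [fl fB fx] := nf; split; last by rewrite fx sqrE.
    pose F : {linear X -> R[i]^o} :=
      HB.pack f (GRing.isLinear.Build _ _ _ _ f fl).
    by split=> //; apply: (@bounded_continuous _ _ _ F _ fB).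
  by rewrite nrmE (norming_opnorm nf).
split=> //; last by rewrite fx sqrE.
pose F : {linear X -> R[i]^o} := HB.pack f (GRing.isLinear.Build _ _ _ _ f fl).
have [c _ fcB] := @continuous_bounded _ _ _ F fc.
have fE : opnorm f = nrm x by apply: complexI; rewrite fn nrmE.
by rewrite -fE => v; exact: (@nrm_le_opnorm _ _ _ F _ fcB).
Qed.

Lemma normingZ x f (c : R) :
  norming x f -> norming (c%:C *: x) (fun v => c%:C * f v).
Proof.
move=> [fl fB fx]; split.
- by move=> a u v; rewrite fl mulrDr; congr (_ + _); rewrite mulrCA.
- move=> v; rewrite nrmM nrmC nrmZC -mulrA ler_wpM2l//.
- have -> : f (c%:C *: x) = c%:C * f x.
    pose F : {linear X -> R[i]^o} :=
      HB.pack f (GRing.isLinear.Build _ _ _ _ f fl).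
    exact: (linearZ_LR F).
  by rewrite fx nrmZC exprMn real_normK ?num_real// expr2 -mulrA -!rmorphM.
Qed.

(** Smoothness speaks of unit vectors only; dividing by [|x|] reduces the other
    nonzero vectors to that case. *)
Lemma smooth_norming_unique x : smooth X -> exists! f, norming x f.
Proof.
move=> smX; have [->|x0] := eqVneq x 0.
  have z f : norming 0 f -> f = cst 0.
    move=> [_ fB _]; apply/funext => v; apply/eqP; rewrite -nrm_eq0.
    by rewrite eq_le nrm_ge0 andbT (le_trans (fB v))// nrm0 mul0r.
  exists (cst 0); split=> [|f /z//]; split.
  - by move=> a u v; rewrite /= scaler0 addr0.
  - by move=> v; rewrite /= !nrm0 mul0r.
  - by rewrite /= nrm0 expr0n.
have nx : nrm x != 0 by rewrite nrm_eq0.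
have cK (c : R) : c != 0 -> c%:C * c^-1%:C = 1 :> R[i].
  by move=> c0; rewrite -rmorphM divff.
pose u := (nrm x)^-1%:C *: x.
have xu : x = (nrm x)%:C *: u by rewrite scalerA cK// scale1r.
have nu : nrm u = 1 by rewrite nrmZC ger0_norm ?invr_ge0 ?nrm_ge0// mulVf.
have nuC : `|u| = 1 by rewrite nrmE nu.
have [g [gP gU]] := smX u nuC.
have uP f : norming u f <-> [/\ continuous_dual X f, opnorm f = 1 & f u = 1].
  rewrite norming_dualP nuC expr1n; split=> -[? fn ?]; split=> //.
    exact: complexI.
  by rewrite fn.
exists (fun v => (nrm x)%:C * g v); split.
  by rewrite [in norming _]xu; apply/normingZ/uP.
move=> f fx; have /(_ (nrm x)^-1) := normingZ _ fx.
move/uP/gU => ->; apply/funext => v.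
by rewrite mulrA cK// mul1r.
Qed.

(** All that the spectral theory below uses of the duality mapping. *)
Lemma smooth_duality : smooth X -> exists J : X -> {scalar X},
  [/\ forall x, duality x = J x :> (X -> R[i]),
      forall x v, nrm (J x v) <= nrm x * nrm v,
      forall x, J x x = (nrm x ^+ 2)%:C &
      forall x (f : X -> R[i]), scalar f ->
        (forall v, nrm (f v) <= nrm x * nrm v) ->
        f x = (nrm x ^+ 2)%:C -> f =1 J x].
Proof.
move=> smX.
have dual x : norming x (duality x).
  apply/norming_dualP; have [f [/norming_dualP fx _]] := smooth_norming_unique x smX.
  by rewrite /duality; case: xgetP => [_ _ //|/(_ f)/(_ fx)].
have lin x : linear (duality x) by have [] := dual x.
pose J x : {scalar X} :=
  HB.pack (duality x : X -> R[i]) (GRing.isLinear.Build _ _ _ _ _ (lin x)).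
exists J; split=> // [x v|x|x f fl fB fx v].
- by have [_ + _] := dual x; exact.
- by have [] := dual x.
have [g [gP gU]] := smooth_norming_unique x smX.
rewrite /J /= -(gU _ (dual x)) (gU f)//; split.
Qed.

End Duality.

(** * Compact operators and sequences *)

Section CompactOperator.
Variables (R : realType) (X : normedModType R[i]) (T : {linear X -> X}).
Hypothesis compactT : compact_operator T.

(** Cluster points do the work of convergent subsequences here: all estimates
    need only one late index at a time. *)
Lemma compact_seq_cluster (u : nat -> X) (r : R) :
  (forall n, nrm (u n) <= r) ->
  exists p, forall e : R, 0 < e -> forall N, exists2 n, (N <= n)%N &
    nrm (T (u n) - p) < e.
Proof.
wlog r1 : u r / r = 1 => [hwlog uB|].
  pose s := Num.max r 1; have s0 : 0 < s by rewrite lt_max ltr01 orbT.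
  have [|p pP] := hwlog (fun n => s^-1%:C *: u n) 1 erefl.
    move=> n; rewrite nrmZC ger0_norm ?invr_ge0 ?(ltW s0)// mulrC.
    by rewrite ler_pdivrMr// mul1r le_max uB.
  exists (s%:C *: p) => e e0 N.
  have [n Nn np] := pP (e / s) (divr_gt0 e0 s0) N; exists n => //.
  have -> : T (u n) - s%:C *: p = s%:C *: (T (s^-1%:C *: u n) - p).
    rewrite scalerBr (linearZ_LR T) scalerA -rmorphM divff ?gt_eqF//.
    by rewrite scale1r.
  by rewrite nrmZC gtr0_norm// mulrC -ltr_pdivlMr.
rewrite {}r1 => uB.
have cptT : compact (closure (T @` unit_ball X)) by rewrite -precompactE.
have [|p [_ pP]] := cptT ((T \o u) @ \oo) _.
  exists 0%N => // n _; apply: subset_closure; exists (u n) => //.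
  by rewrite /unit_ball /= nrmE lecR.
exists p => e e0 N.
have [||_ [[n /= Nn <-] np]] :=
  pP [set T (u n) | n in [set n | (N <= n)%N]] [set q | nrm (q - p) < e].
- by exists N => // n /= Nn; exists n.
- apply/nbhs_normP; exists e%:C => /=; first by rewrite ltcR.
  by move=> q /=; rewrite nrmE ltcR nrm_distC.
by exists n.
Qed.

Lemma compact_not_separated (u : nat -> X) (e : R) :
  (forall n, nrm (u n) <= 1) -> 0 < e ->
  ~ (forall m n, (m < n)%N -> e <= nrm (T (u m) - T (u n))).
Proof.
move=> uB e0 sep; have [p pP] := compact_seq_cluster uB.
have e20 : 0 < e / 2 by rewrite divr_gt0.
have [m _ mp] := pP _ e20 0%N; have [n mn np] := pP _ e20 m.+1.
have := sep m n mn; rewrite leNgt => /negP; apply.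
have -> : T (u m) - T (u n) = (T (u m) - p) - (T (u n) - p).
  by rewrite opprB addrA subrK.
by apply: le_lt_trans (ler_nrmB _ _) _; lra.
Qed.

End CompactOperator.

Lemma small_inverse (R : realType) (c e : R) : 0 < e ->
  exists N, forall n, (N <= n)%N -> c / n.+1%:R <= e.
Proof.
move=> e0; exists (Num.bound `|c / e|) => n Nn.
rewrite ler_pdivrMr ?ltr0Sn// mulrC -ler_pdivrMr//.
apply: (le_trans (ler_norm _)); apply: (le_trans (ltW (archi_boundP _))) => //.
by rewrite ler_nat leqW.
Qed.

(** Dependent choice in which a term may depend on all the previous ones. *)
Lemma greedy_sequence (A : Type) (Q : seq A -> A -> Prop) :
  (forall s, exists a, Q s a) -> exists u, forall n, Q (mkseq u n) (u n).
Proof.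
move=> /choice[next nextP].
pose g := fix g n := if n is m.+1 then rcons (g m) (next (g m)) else [::].
exists (next \o g) => n.
have -> : mkseq (next \o g) n = g n.
  by elim: n => // n IHn; rewrite mkseqS IHn.
exact: nextP.
Qed.

(** * Eigenvectors of a compact self-adjoint operator *)

Lemma sqr_gap (R : realFieldType) (s a d : R) :
  0 <= a -> a <= s -> s - d <= a -> s ^+ 2 - 2 * s * d <= a ^+ 2.
Proof. by nra. Qed.

(** The arithmetic that ends the estimate of [|T p|] in [norm_attained]. *)
Lemma gap_absurd (R : realFieldType) (s d a t p x : R) :
  d <= (s - p) / 2 -> s - d <= a -> a <= t -> t <= p + x -> ~ x < (s - p) / 2.
Proof. by move=> *; lra. Qed.

Section SelfAdjoint.
Variables (R : realType) (X : normedModType R[i]) (T : {linear X -> X}).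
(** [J] stands for the duality mapping of a smooth space. *)
Variable J : X -> {scalar X}.
Hypothesis J_le : forall x v, nrm (J x v) <= nrm x * nrm v.
Hypothesis J_diag : forall x, J x x = (nrm x ^+ 2)%:C.
Hypothesis J_unique : forall x (f : X -> R[i]), scalar f ->
  (forall v, nrm (f v) <= nrm x * nrm v) -> f x = (nrm x ^+ 2)%:C -> f =1 J x.
Hypothesis J_adj : forall x v, J x (T v) = J (T x) v.

Lemma J_scale (c : R) x v : J (c%:C *: x) v = c%:C * J x v.
Proof.
apply/esym/(@J_unique _ (fun v => c%:C * J x v)).
- by move=> a u w; rewrite linearP mulrDr mulrCA.
- by move=> w; rewrite nrmM nrmC nrmZC -mulrA ler_wpM2l.
- rewrite linearZ /= J_diag nrmZC exprMn real_normK ?num_real//.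
  by rewrite expr2 -mulrA -!rmorphM.
Qed.

(** Where self-adjointness meets eigenvectors: [J x] is an eigenvector of the
    transpose of [T]. *)
Lemma J_eigen (l : R) x v : T x = l%:C *: x -> J x (T v) = l%:C * J x v.
Proof. by move=> Tx; rewrite J_adj Tx J_scale. Qed.

Lemma J_eigen_orth (l m : R) x v : l != m ->
  T x = l%:C *: x -> T v = m%:C *: v -> J x v = 0.
Proof.
move=> lm Tx Tv; apply/eqP; have := J_eigen v Tx.
rewrite Tv linearZ /= => /eqP; rewrite -subr_eq0 -mulrBl mulf_eq0 -rmorphB.
by rewrite -(rmorph0 (real_complex R)) (inj_eq (@complexI R)) subr_eq0 eq_sym
  (negbTE lm).
Qed.

(** Birkhoff orthogonality: a vector is the shortest in its translates by the
    kernel of its duality functional. *)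
Lemma J_orth_le x v : J x (v - x) = 0 -> nrm x <= nrm v.
Proof.
rewrite linearB => /eqP; rewrite subr_eq0 J_diag => /eqP Jxv.
have := J_le x v; rewrite Jxv nrmC ger0_norm ?sqr_ge0//.
have [->|x0] := eqVneq x 0; first by rewrite nrm0 nrm_ge0.
by rewrite expr2 ler_pM2l// nrm_gt0.
Qed.

(** Because [|T x| ^ 2 = J (T x) (T x) = J x (T (T x))]. *)
Lemma paranormal x : nrm (T x) ^+ 2 <= nrm x * nrm (T (T x)).
Proof.
have := J_le x (T (T x)); rewrite J_adj J_diag nrmC ger0_norm ?sqr_ge0//.
Qed.

Hypothesis compactT : compact_operator T.
Variable B : R.
Hypothesis B_ge0 : 0 <= B.
Hypothesis T_le : forall v, nrm (T v) <= B * nrm v.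

Section InvariantSubspace.
Variable M : set X.
Hypothesis clM : closed M.
Hypothesis M0 : M 0.
Hypothesis MP : forall a u v, M u -> M v -> M (a *: u + v).
Hypothesis TM : forall v, M v -> M (T v).

Let MZ a u : M u -> M (a *: u).
Proof. by move=> Mu; rewrite -[_ *: _]addr0; exact: MP. Qed.

Let MB u v : M u -> M v -> M (u - v).
Proof. by move=> Mu Mv; rewrite addrC -scaleN1r; exact: MP. Qed.

Let Msum n (F : nat -> X) : (forall k, M (F k)) -> M (\sum_(k < n) F k).
Proof.
move=> MF; elim/big_ind: _ => // u v Mu Mv.
by rewrite -(scale1r u); exact: MP.
Qed.

Lemma restricted_norm : exists S : R, [/\ 0 <= S,
  forall v, M v -> nrm (T v) <= S * nrm v &
  forall e, 0 < e -> exists v, [/\ M v, nrm v <= 1 & S - e < nrm (T v)]].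
Proof.
set A := [set nrm (T v) | v in M `&` [set v | nrm v <= 1]].
have supA : has_sup A.
  split; first by exists (nrm (T 0)); exists 0 => //=; rewrite nrm0.
  exists B => _ [v [_ /= v1] <-]; apply: (le_trans (T_le v)).
  by rewrite ler_piMr.
exists (sup A); split=> [|v Mv|e e0].
- apply: (@le_trans _ _ (nrm (T 0))); first exact: nrm_ge0.
  by apply: (ub_le_sup supA.2); exists 0 => //=; rewrite nrm0.
- have [->|v0] := eqVneq v 0; first by rewrite linear0 !nrm0 mulr0.
  have nv : 0 < nrm v by rewrite nrm_gt0.
  rewrite -ler_pdivrMr//.
  have -> : nrm (T v) / nrm v = nrm (T ((nrm v)^-1%:C *: v)).
    by rewrite linearZ_LR nrmZC ger0_norm ?invr_ge0 ?nrm_ge0// mulrC.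
  apply: (ub_le_sup supA.2); exists ((nrm v)^-1%:C *: v) => //.
  split; first exact: MZ.
  by rewrite /= nrmZC ger0_norm ?invr_ge0 ?nrm_ge0// mulVf// gt_eqF.
- by have [_ [v [Mv v1] <-]] := sup_adherent e0 supA; exists v.
Qed.

(** Compactness turns a maximizing sequence [u_n] into a vector on which [T]
    attains its norm: a cluster point [p] of [T u_n] has norm at most [S], and
    [paranormal] forces [|T p| >= S ^ 2]. *)
Lemma norm_attained (S : R) : 0 <= S ->
  (forall v, M v -> nrm (T v) <= S * nrm v) ->
  (forall e, 0 < e -> exists v, [/\ M v, nrm v <= 1 & S - e < nrm (T v)]) ->
  exists p, [/\ M p, nrm p = S & nrm (T p) = S ^+ 2].
Proof.
move=> S0 S_le S_near.
have /choice [u uP] : forall n, exists v,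
    [/\ M v, nrm v <= 1 & S - n.+1%:R^-1 < nrm (T v)].
  by move=> n; apply: S_near; rewrite invr_gt0 ltr0Sn.
have uM n : M (u n) by have [] := uP n.
have u1 n : nrm (u n) <= 1 by have [] := uP n.
have uS n : S - n.+1%:R^-1 < nrm (T (u n)) by have [] := uP n.
have TuS n : nrm (T (u n)) <= S.
  by rewrite (le_trans (S_le _ (uM n)))// ler_piMr.
have [p pP] := compact_seq_cluster compactT u1.
have Mp : M p.
  apply: (closed_approx clM) => e e0; have [n _ np] := pP e e0 0%N.
  by exists (T (u n)); [exact: TM|rewrite nrm_distC].
have pS : nrm p <= S.
  rewrite leNgt; apply/negP => pS.
  have gap : 0 < nrm p - S by rewrite subr_gt0.
  have [n _ np] := pP _ gap 0%N.
  have := ler_nrmB (T (u n)) (T (u n) - p); rewrite subKr.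
  by have := TuS n; move: np; lra.
have TpS : S ^+ 2 <= nrm (T p).
  rewrite leNgt; apply/negP => TpS.
  have g0 : 0 < (S ^+ 2 - nrm (T p)) / 2 by rewrite divr_gt0 // subr_gt0.
  have [N NP] := small_inverse (2 * S) g0.
  have B1 : 0 < B + 1 by rewrite ltr_wpDl.
  have [n Nn np] := pP _ (divr_gt0 g0 B1) N.
  have Sa : S ^+ 2 - 2 * S / n.+1%:R <= nrm (T (u n)) ^+ 2.
    exact: sqr_gap (nrm_ge0 _) (TuS n) (ltW (uS n)).
  have TT : nrm (T (u n)) ^+ 2 <= nrm (T (T (u n))).
    by rewrite (le_trans (paranormal (u n)))// ler_piMl ?nrm_ge0.
  have TTp : nrm (T (T (u n))) <= nrm (T p) + nrm (T (T (u n) - p)).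
    by rewrite (le_trans _ (ler_nrmD _ _))// linearB addrC subrK.
  have : nrm (T (T (u n) - p)) < (S ^+ 2 - nrm (T p)) / 2.
    apply: (le_lt_trans (T_le _)); apply: (@le_lt_trans _ _ (
      (B + 1) * nrm (T (u n) - p))); first by rewrite ler_wpM2r ?nrm_ge0// lerDl.
    by rewrite mulrC -ltr_pdivlMr.
  exact: gap_absurd (NP n Nn) Sa TT TTp.
exists p; split=> //.
- apply/eqP; rewrite eq_le pS /=; have := S_le _ Mp.
  move: S0; rewrite (le_eqVlt 0) => /orP[/eqP <- _|S0' Tp]; first exact: nrm_ge0.
  by rewrite -(ler_pM2l S0') -expr2 (le_trans TpS).
- apply/eqP; rewrite eq_le TpS andbT (le_trans (S_le _ Mp))//.
  by rewrite expr2 ler_wpM2l.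
Qed.

(** If [T] attains its norm [S] on [M] at [p], then by uniqueness of the duality
    functional [J p] is invariant under [(T / S) ^ 2]: both functionals have
    norm [S] and take the value [S ^ 2] at [p]. *)
Lemma J_norm_attained (S : R) p : 0 < S ->
  (forall v, M v -> nrm (T v) <= S * nrm v) ->
  M p -> nrm p = S -> nrm (T p) = S ^+ 2 ->
  forall v, J p ((S ^- 2)%:C *: T (T v)) = J p v.
Proof.
move=> S0 S_le Mp pS TpS.
have iS2 : 0 <= S ^- 2 by rewrite invr_ge0 sqr_ge0.
have Sn0 : S != 0 by rewrite gt_eqF.
apply: J_unique => [a u v|v|].
- have -> : T (T (a *: u + v)) = a *: T (T u) + T (T v) by rewrite !linearP.
  by rewrite scalerDr scalerA mulrC -scalerA linearP.
- rewrite linearZ/= nrmM nrmC ger0_norm// !J_adj.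
  rewrite mulrC ler_pdivrMr ?exprn_gt0// (le_trans (J_le _ _))//.
  rewrite mulrAC ler_wpM2r ?nrm_ge0// pS (le_trans (S_le _ (TM Mp)))//.
  by rewrite TpS expr2 mulrA.
- rewrite linearZ/= J_adj J_diag TpS pS -rmorphM; congr (_%:C).
  by rewrite [X in _ * X]expr2 mulKf// expf_neq0.
Qed.

(** The Cesaro means of the iterates of [A = (T / S) ^ 2] at [p] stay on the
    hyperplane [J p = S ^ 2], are almost fixed by [A], and cluster by
    compactness: the cluster point is a nonzero fixed point of [A]. *)
Lemma square_eigenvector (S : R) p : 0 < S ->
  (forall v, M v -> nrm (T v) <= S * nrm v) ->
  M p -> nrm p = S -> nrm (T p) = S ^+ 2 ->
  exists q, [/\ M q, q != 0 & T (T q) = (S ^+ 2)%:C *: q].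
Proof.
move=> S0 S_le Mp pS TpS.
have S20 : 0 < S ^+ 2 by rewrite exprn_gt0.
have iS2 : 0 <= S ^- 2 by rewrite invr_ge0 sqr_ge0.
pose A : X -> X := fun v => (S ^- 2)%:C *: T (T v).
have AB u v : A (u - v) = A u - A v by rewrite /A !linearB.
have MA v : M v -> M (A v) by move=> Mv; apply/MZ/TM/TM.
have A_le v : M v -> nrm (A v) <= nrm v.
  move=> Mv; rewrite nrmZC (ger0_norm iS2) mulrC ler_pdivrMr//.
  rewrite (le_trans (S_le _ (TM Mv)))// [leRHS]mulrC expr2 -mulrA ler_pM2l//.
  exact: S_le.
have JA : forall v, J p (A v) = J p v by exact: J_norm_attained.
pose it k := iter k A p.
have Mit k : M (it k) by elim: k => //= k; exact: MA.
have it_le k : nrm (it k) <= S.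
  by elim: k => [|k IHk] /=; [rewrite pS|rewrite (le_trans (A_le _ (Mit k)))].
have Jit k : J p (it k) = (S ^+ 2)%:C.
  by elim: k => [|k IHk] /=; [rewrite J_diag pS|rewrite JA].
pose z n := (n.+1%:R^-1)%:C *: \sum_(k < n.+1) it k.
have n1 n : 0 < n.+1%:R^-1 :> R by rewrite invr_gt0 ltr0Sn.
have Mz n : M (z n) by apply/MZ/Msum.
have z_le n : nrm (z n) <= S.
  rewrite nrmZC gtr0_norm// mulrC ler_pdivrMr ?ltr0Sn//.
  apply: (le_trans (ler_nrm_sum _ _ _)).
  apply: (@le_trans _ _ (\sum_(k < n.+1) S)); first exact: ler_sum.
  by rewrite sumr_const card_ord mulr_natr.
have Jz n : J p (z n) = (S ^+ 2)%:C.
  rewrite linearZ linear_sum /= (eq_bigr (fun=> (S ^+ 2)%:C))//.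
  rewrite sumr_const card_ord -(rmorphMn (real_complex R)) -rmorphM; congr (_%:C).
  by rewrite -[S ^+ 2 *+ _]mulr_natl mulKf// pnatr_eq0.
have Az n : nrm (A (z n) - z n) <= (2 * S) / n.+1%:R.
  have -> : A (z n) - z n = (n.+1%:R^-1)%:C *: (it n.+1 - p).
    have A_sum m : A (\sum_(k < m) it k) = \sum_(k < m) it k.+1.
      by rewrite /A !linear_sum.
    have AZ a v : A (a *: v) = a *: A v.
      by rewrite /A 2!(linearZ_LR T) scalerA mulrC -scalerA.
    rewrite AZ -scalerBr A_sum [X in _ - X]big_ord_recl big_ord_recr /=.
    by rewrite [X in X - _]addrC [X in _ - X]addrC addrKA.
  rewrite nrmZC gtr0_norm// mulrC ler_pM2r//.
  rewrite (le_trans (ler_nrmB _ _))//; move: (it_le n.+1) pS.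
  by move=> h ->; rewrite mulr2n mulrDl mul1r lerD2r.
have Tz_le n : nrm (T (z n)) <= S * S.
  by rewrite (le_trans (S_le _ (Mz n)))// ler_pM2l.
have [q0 q0P] := compact_seq_cluster compactT Tz_le.
pose q := (S ^- 2)%:C *: q0.
have qP e : 0 < e -> forall N, exists2 n, (N <= n)%N & nrm (A (z n) - q) < e.
  move=> e0 N; have [n Nn nq] := q0P (S ^+ 2 * e) (mulr_gt0 S20 e0) N.
  exists n => //; rewrite -scalerBr nrmZC (ger0_norm iS2).
  by rewrite mulrC ltr_pdivrMr// mulrC.
have Mq : M q.
  apply: (closed_approx clM) => e e0; have [n _ nq] := qP e e0 0%N.
  by exists (A (z n)); [exact: MA|rewrite nrm_distC].
exists q; split=> //.
  apply/eqP => q0E; have [n _] := qP S S0 0%N; rewrite q0E subr0.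
  have := J_le p (A (z n)); rewrite JA Jz nrmC (gtr0_norm S20) pS expr2.
  by rewrite ler_pM2l// => /le_lt_trans h /h; rewrite ltxx.
have Aq : A q = q.
  apply/eqP; rewrite -subr_eq0 -nrm_eq0 eq_le nrm_ge0 andbT.
  apply/ler_addgt0Pl => e e0; rewrite addr0.
  have e4 : 0 < e / 4 by rewrite divr_gt0.
  have [N NP] := small_inverse (2 * S) e4.
  have [n Nn nq] := qP _ e4 N.
  have -> : A q - q = A (q - A (z n)) + A (A (z n) - z n) + (A (z n) - q).
    by rewrite !AB !addrA !subrK.
  have h1 : nrm (A (q - A (z n))) <= e / 4.
    rewrite (le_trans (A_le _ _))//; first by apply: MB => //; exact: MA.
    by rewrite nrm_distC ltW.
  have h2 : nrm (A (A (z n) - z n)) <= e / 4.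
    rewrite (le_trans (A_le _ _))//; first by apply: MB => //; exact: MA.
    exact: le_trans (Az n) (NP n Nn).
  have := ler_nrmD (A (q - A (z n)) + A (A (z n) - z n)) (A (z n) - q).
  have := ler_nrmD (A (q - A (z n))) (A (A (z n) - z n)).
  by move: h1 h2 nq; lra.
by rewrite -[in RHS]Aq scalerA -rmorphM mulfV ?scale1r// gt_eqF.
Qed.

(** The norm of [T] on a closed invariant subspace is, up to its sign, an
    eigenvalue: [T ^ 2 - S ^ 2 = (T - S) (T + S)]. *)
Lemma extremal_eigenvalue : exists l : R,
  (forall v, M v -> nrm (T v) <= `|l| * nrm v) /\
  (l != 0 -> exists x, [/\ M x, x != 0 & T x = l%:C *: x]).
Proof.
have [S [S0 S_le S_near]] := restricted_norm.
have [Sz|Sn0] := eqVneq S 0.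
  by exists 0; rewrite eqxx normr0; split=> // v /S_le; rewrite Sz.
have Sgt0 : 0 < S by rewrite lt0r Sn0.
have [p [Mp pS TpS]] := norm_attained S0 S_le S_near.
have [q [Mq q0 TTq]] := square_eigenvector Sgt0 S_le Mp pS TpS.
have [Tq|Tq] := eqVneq (T q) (- S%:C *: q).
  exists (- S); rewrite normrN ger0_norm//; split=> // _.
  by exists q; split=> //; rewrite rmorphN.
exists S; rewrite ger0_norm//; split=> // _.
exists (S%:C *: q + T q); split.
- by apply: MP => //; exact: TM.
- by apply: contra Tq; rewrite addrC addr_eq0 scaleNr.
- by rewrite linearP TTq scalerDr scalerA -rmorphM -expr2 addrC.
Qed.

End InvariantSubspace.

(** * Eigenspaces are finite-dimensional and complemented *)

(** [J x] of norm [1] sends the difference to [l]. *)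
Lemma eigen_separated (l : R) x y :
  nrm x = 1 -> T x = l%:C *: x -> J x (T y) = 0 ->
  `|l| <= nrm (T x - T y).
Proof.
move=> x1 Tx JTy; have := J_le x (T x - T y).
rewrite linearB JTy subr0 Tx linearZ /= J_diag x1 expr1n mulr1 nrmC.
by rewrite mul1r.
Qed.

Section Eigenspace.
Variable l : R.
Hypothesis l_neq0 : l != 0.

Let E x := T x = l%:C *: x.

(** Birkhoff orthogonality is not symmetric, so the order of the list matters:
    each functional kills the later vectors only. *)
Definition eigen_system (s : seq X) : Prop :=
  (forall x, x \in s -> T x = l%:C *: x /\ nrm x = 1) /\
  pairwise (fun x y => J x y == 0) s.

(** An infinite system would contradict compactness, its images under [T] being
    [|l|]-separated. *)
Lemma maximal_eigen_system : exists s, eigen_system s /\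
  forall x, T x = l%:C *: x -> (forall y, y \in s -> J y x = 0) -> x = 0.
Proof.
apply: contrapT => nomax.
pose Q s x := eigen_system s -> eigen_system (rcons s x).
have [s|u uP] := @greedy_sequence X Q.
  have [sP|] := pselect (eigen_system s); last by exists 0.
  have [x [Ex [xs x0]]] : exists x, E x /\
      ((forall y, y \in s -> J y x = 0) /\ x <> 0).
    apply: contrapT => nox; apply: nomax; exists s; split=> // x Ex xs.
    by apply: contrapT => x0; apply: nox; exists x.
  have nx : 0 < nrm x by rewrite nrm_gt0; apply/eqP.
  exists ((nrm x)^-1%:C *: x) => _; split=> [y|].
    rewrite mem_rcons inE => /predU1P[->|]; last exact: sP.1.
    rewrite linearZ_LR Ex !scalerA mulrC; split=> //.
    by rewrite nrmZC gtr0_norm ?invr_gt0// mulVf// gt_eqF.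
  rewrite pairwise_rcons sP.2 andbT; apply/allP => y ys.
  by rewrite linearZ /= xs// mulr0.
have sysP n : eigen_system (mkseq u n).
  elim: n => [|n IHn]; first by split.
  by rewrite mkseqS; exact: uP.
have uE n : E (u n) /\ nrm (u n) = 1.
  apply: (sysP n.+1).1; apply/mapP; exists n => //.
  by rewrite mem_iota add0n leq0n /=.
apply: (@compact_not_separated _ _ _ compactT u `|l|).
- by move=> n; rewrite (uE n).2.
- by rewrite normr_gt0.
move=> m n mn; have [[Em m1] [En _]] := (uE m, uE n).
apply: eigen_separated => //; rewrite En linearZ /=.
have um : u m \in mkseq u n by apply/mapP; exists m; rewrite ?mem_iota.
have := (sysP n.+1).2; rewrite mkseqS pairwise_rcons => /andP[/allP/(_ _ um)].
by move=> /eqP->; rewrite mulr0.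
Qed.

(** For an eigen-system this is the projection onto the common kernel of
    the functionals [J x], [x] in [s]. *)
Definition deflate (s : seq X) (v : X) : X :=
  foldl (fun w x => w - J x w *: x) v s.

Lemma deflate_linear s : linear (deflate s).
Proof.
move=> a u v; elim: s u v => //= x s IHs u v; rewrite -IHs; congr (deflate s _).
by rewrite linearP scalerDl scalerBr scalerA opprD addrACA.
Qed.

Lemma deflate_bounded s :
  exists2 c : R, 0 <= c & forall v, nrm (deflate s v) <= c * nrm v.
Proof.
elim: s => [|x s [c c0 cP]].
  by exists 1 => // v /=; rewrite mul1r.
exists (c * (1 + nrm x * nrm x)) => [|v].
  by rewrite mulr_ge0// addr_ge0// mulr_ge0// nrm_ge0.
apply: (le_trans (cP _)); rewrite -mulrA ler_wpM2l//.
rewrite mulrDl mul1r (le_trans (ler_nrmB _ _))// lerD2l nrmZ.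
by rewrite mulrAC ler_wpM2r ?nrm_ge0.
Qed.

Lemma deflate_comm s v : (forall x, x \in s -> T x = l%:C *: x) ->
  T (deflate s v) = deflate s (T v).
Proof.
elim: s v => //= x s IHs v sE; rewrite IHs => [|y ys]; last first.
  by apply: sE; rewrite inE ys orbT.
have Ex := sE x (mem_head _ _).
by rewrite linearB linearZ_LR (J_eigen v Ex) Ex scalerA mulrC.
Qed.

Lemma deflate_orth s v x : eigen_system s -> x \in s -> J x (deflate s v) = 0.
Proof.
elim: s v => //= y s IHs v [sE /= /andP[/allP ys sP]].
have sys : eigen_system s.
  by split=> // z zs; apply: sE; rewrite inE zs orbT.
rewrite inE => /predU1P[->|xs]; last exact: IHs.
have -> w : J y (deflate s w) = J y w.
  elim: s ys w {IHs sE sP sys} => //= z s IHs ys w.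
  rewrite IHs => [|t ts]; last by apply: ys; rewrite inE ts orbT.
  by rewrite linearB linearZ /= (eqP (ys z (mem_head _ _))) mulr0 subr0.
rewrite linearB linearZ /= J_diag (sE y (mem_head _ _)).2 expr1n mulr1.
by rewrite subrr.
Qed.

Lemma deflate_span s v : exists c : 'I_(size s) -> R[i],
  v - deflate s v = \sum_(i < size s) c i *: s`_i.
Proof.
elim: s v => [|x s IHs] v /=.
  by exists (fun=> 0); rewrite big_ord0 subrr.
have [c cP] := IHs (v - J x v *: x).
exists (fun i => oapp c (J x v) (unlift ord0 i)).
rewrite big_ord_recl /= unlift_none /=.
rewrite (eq_bigr (fun i => c i *: s`_i)); last by move=> i _; rewrite liftK.
by rewrite -cP addrA; congr (_ - _); rewrite addrC subrK.
Qed.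

(** The projection is [1 - deflate s] for a maximal system [s]: its range is
    spanned by [s], and maximality makes [deflate s] vanish on eigenvectors. *)
Lemma spectral_projection : exists P : {linear X -> X},
  [/\ finite_dimensional (ker_sub T l%:C),
      exists c : R, forall v, nrm (P v) <= c * nrm v,
      forall v, T (P v) = l%:C *: P v,
      forall v, T v = l%:C *: v -> P v = v &
      forall v, P (T v) = l%:C *: P v].
Proof.
have [s [sys smax]] := maximal_eigen_system.
have sE x : x \in s -> T x = l%:C *: x by move=> /sys.1[].
pose K : {linear X -> X} :=
  HB.pack (deflate s) (GRing.isLinear.Build _ _ _ _ _ (deflate_linear s)).
have KE v : deflate s v = K v by [].
have spanE (c : 'I_(size s) -> R[i]) :
    T (\sum_(i < size s) c i *: s`_i) = l%:C *: (\sum_(i < size s) c i *: s`_i).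
  rewrite linear_sum scaler_sumr; apply: eq_bigr => i _.
  by rewrite linearZ_LR sE ?mem_nth// !scalerA mulrC.
have TPE v : T (v - K v) = l%:C *: (v - K v).
  by have [c ->] := deflate_span s v.
have K0 v : T v = l%:C *: v -> K v = 0.
  move=> Ev; apply: smax => [|x xs]; last exact: deflate_orth.
  by rewrite -KE deflate_comm// Ev KE linearZ_LR.
have lin : linear (fun v => v - K v).
  by move=> a u v; rewrite linearP scalerBr opprD addrACA.
pose P : {linear X -> X} :=
  HB.pack (fun v => v - K v) (GRing.isLinear.Build _ _ _ _ _ lin).
exists P; split=> //=.
- exists (size s), (fun i => s`_i); apply/seteqP; split=> [v|_ [c _ <-]] /=.
    move=> /subr0_eq Ev; have [c] := deflate_span s v.
    by rewrite KE (K0 _ Ev) subr0 => ->; exists c.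
  by rewrite /ker_sub /= spanE subrr.
- have [c c0 cP] := deflate_bounded s; exists (1 + c) => v.
  by rewrite mulrDl mul1r (le_trans (ler_nrmB _ _))// lerD2l.
- by move=> v Ev; rewrite -[LHS]/(v - K v) K0// subr0.
- by move=> v; rewrite -TPE linearB [in RHS](deflate_comm _ sE).
Qed.

End Eigenspace.

(** * Decay along the iterates *)

(** Self-adjointness carries powers of [T] across [J]. With [x = T ^ m y_m],
    where [y_m = \sum_i l_i ^- m a_i] shrinks like [al ^- m], this gives
    [|J x w| = |J y_m (T ^ m w)| <= C (be / al) ^ m], which tends to [0]. *)
Lemma J_decay (I : finType) (D : pred I) (a : I -> X) (l : I -> R) (w : X)
    (al be : R) :
  0 <= be -> be < al ->
  (forall i, D i -> T (a i) = (l i)%:C *: a i) ->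
  (forall i, D i -> al <= `|l i|) ->
  (forall m, nrm (iter m T w) <= be ^+ m * nrm w) ->
  J (\sum_(i | D i) a i) w = 0.
Proof.
move=> be0 beal Ta al_le w_le; set x := \sum_(i | D i) a i.
have al0 : 0 < al by exact: le_lt_trans beal.
pose G := (\sum_(i | D i) nrm (a i)) * nrm w.
(* [J] itself is not additive, but it moves whole powers of [T]. *)
have J_iter m y v : J (iter m T y) v = J y (iter m T v).
  by elim: m v => //= m IHm v; rewrite -J_adj IHm -iterSr.
have bound m : nrm (J x w) <= G * (be / al) ^+ m.
  pose y := \sum_(i | D i) ((l i)^-1 ^+ m)%:C *: a i.
  have -> : x = iter m T y.
    have iterE n i c : D i ->
        iter n T (c%:C *: a i) = (c * l i ^+ n)%:C *: a i.
      move=> Di; elim: n => [|n IHn] /=; first by rewrite expr0 mulr1.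
      by rewrite IHn linearZ_LR Ta// scalerA -rmorphM exprSr mulrA.
    have iter_sum n (F : I -> X) :
        iter n T (\sum_(i | D i) F i) = \sum_(i | D i) iter n T (F i).
      by elim: n => //= n ->; rewrite linear_sum.
    rewrite iter_sum; apply: eq_bigr => i Di; rewrite iterE//.
    rewrite -exprMn mulVf ?expr1n ?scale1r// -normr_gt0.
    exact: lt_le_trans al0 (al_le i Di).
  rewrite J_iter (le_trans (J_le _ _))//.
  have y_le : nrm y <= (\sum_(i | D i) nrm (a i)) * al ^- m.
    apply: (le_trans (ler_nrm_sum _ _ _)).
    rewrite mulr_suml ler_sum// => i Di; rewrite nrmZC mulrC ler_wpM2l ?nrm_ge0//.
    rewrite normrX normfV -exprVn lerXn2r ?nnegrE ?invr_ge0 ?normr_ge0 ?(ltW al0)//.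
    by rewrite lef_pV2 ?posrE ?al_le// (lt_le_trans al0)// al_le.
  have -> : G * (be / al) ^+ m =
      (\sum_(i | D i) nrm (a i)) * al ^- m * (be ^+ m * nrm w).
    by rewrite expr_div_n [be ^+ m / _]mulrC /G mulrACA [nrm w * _]mulrC.
  by rewrite ler_pM// nrm_ge0.
have q1 : `|be / al| < 1.
  by rewrite ger0_norm ?divr_ge0 ?(ltW al0)// ltr_pdivrMr// mul1r.
have lim0 := cvg_geometric G q1.
apply/eqP; rewrite -nrm_eq0 eq_le nrm_ge0 andbT.
by apply: (ler_cvg_to (cvg_cst _) lim0); apply: nearW => m; exact: bound.
Qed.

(** * Enumeration of the eigenvalues *)

Section Decomposition.
Variable P : R -> {linear X -> X}.
Hypothesis P_bounded :
  forall l : R, l != 0 -> exists c, forall v, nrm (P l v) <= c * nrm v.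
Hypothesis P_range : forall l : R, l != 0 -> forall v, T (P l v) = l%:C *: P l v.
Hypothesis P_id :
  forall l : R, l != 0 -> forall v, T v = l%:C *: v -> P l v = v.
Hypothesis P_T : forall l : R, l != 0 -> forall v, P l (T v) = l%:C *: P l v.

Lemma P_eigen_orth (l m : R) v : l != 0 -> l != m -> T v = m%:C *: v ->
  P l v = 0.
Proof.
move=> l0 lm Tv; have := P_T l0 v; rewrite Tv linearZ_LR => /eqP.
rewrite -subr_eq0 -scalerBl scaler_eq0 -rmorphB -(rmorph0 (real_complex R)).
by rewrite (inj_eq (@complexI R)) subr_eq0 eq_sym (negbTE lm) => /eqP.
Qed.

(** The part of the space that the eigenvalues in [s] leave unexplained. *)
Definition residual (s : seq R) : set X :=
  [set v | forall l, l \in s -> l != 0 -> P l v = 0].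

Lemma residual_closed s : closed (residual s).
Proof.
have -> : residual s =
    \bigcap_(l in [set l | l \in s /\ l != 0]) [set v | P l v = 0].
  by apply/seteqP; split=> v /= h l => [[]|ls l0]; [exact: h|exact: (h l)].
apply: closed_bigI => l [_ l0]; have [c cP] := P_bounded l0.
exact: closed_kernel cP.
Qed.

Lemma residual_T s v : residual s v -> residual s (T v).
Proof. by move=> sv l ls l0; rewrite P_T// sv// scaler0. Qed.

(** The value [0] marks exhaustion: it occurs exactly when [T] vanishes on the
    residual subspace, and then at all later indices too. *)
Definition greedy_eigenvalues (lam : nat -> R) : Prop := forall n,
  (forall v, residual (mkseq lam n) v -> nrm (T v) <= `|lam n| * nrm v) /\
  (lam n != 0 ->
   exists x, [/\ residual (mkseq lam n) x, x != 0 & T x = (lam n)%:C *: x]).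

Lemma greedy_eigenvalues_exist : exists lam, greedy_eigenvalues lam.
Proof.
apply: (@greedy_sequence R (fun s l =>
  (forall v, residual s v -> nrm (T v) <= `|l| * nrm v) /\
  (l != 0 -> exists x, [/\ residual s x, x != 0 & T x = l%:C *: x]))) => s.
apply: extremal_eigenvalue (@residual_T s).
- exact: residual_closed.
- by move=> l _ _; rewrite linear0.
- by move=> a u v su sv l ls l0; rewrite linearP su// sv// scaler0 addr0.
Qed.

Section Enumeration.
Variable lam : nat -> R.
Hypothesis lamP : greedy_eigenvalues lam.

Let lam_le n v : residual (mkseq lam n) v -> nrm (T v) <= `|lam n| * nrm v.
Proof. exact: (lamP n).1. Qed.

Let mem_lam j n : (j < n)%N -> lam j \in mkseq lam n.
Proof. by move=> jn; apply/mapP; exists j; rewrite ?mem_iota. Qed.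

Let lam_mem l n : l \in mkseq lam n -> exists2 j, (j < n)%N & l = lam j.
Proof. by rewrite /mkseq => /mapP[j]; rewrite mem_iota; exists j. Qed.

Lemma lam_eigen n : lam n != 0 ->
  exists x, [/\ residual (mkseq lam n) x, nrm x = 1 & T x = (lam n)%:C *: x].
Proof.
move=> /(lamP n).2[x [xM x0 Tx]]; have nx : 0 < nrm x by rewrite nrm_gt0.
exists ((nrm x)^-1%:C *: x); split.
- by move=> l ls l0; rewrite linearZ_LR xM// scaler0.
- by rewrite nrmZC gtr0_norm ?invr_gt0// mulVf// gt_eqF.
- by rewrite linearZ_LR Tx !scalerA mulrC.
Qed.

Lemma lam_antitone m n : (m <= n)%N -> `|lam n| <= `|lam m|.
Proof.
move=> mn; have [->|ln0] := eqVneq (lam n) 0; first by rewrite normr0.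
have [x [xM x1 Tx]] := lam_eigen ln0.
have := @lam_le m x; rewrite Tx nrmZC x1 !mulr1; apply=> l lm; apply: xM.
have [j jm ->] := lam_mem lm; exact/mem_lam/(leq_trans jm).
Qed.

Lemma lam_neq m n : (m < n)%N -> lam n != 0 -> lam m != lam n.
Proof.
move=> mn ln0; have [x [xM x1 Tx]] := lam_eigen ln0.
apply/negP => /eqP lmn; have := xM _ (mem_lam mn).
rewrite lmn P_id// => /(_ ln0) x0; move: x1; rewrite x0 nrm0.
by move/esym/eqP; rewrite oner_eq0.
Qed.

Lemma lam_inj m n : lam m != 0 -> lam n != 0 -> lam m = lam n -> m = n.
Proof.
move=> lm0 ln0 lmn; apply/eqP; case: ltngtP => // h.
  by have := lam_neq h ln0; rewrite lmn eqxx.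
by have := lam_neq h lm0; rewrite lmn eqxx.
Qed.

Definition leading (n : nat) (v : X) : X := \sum_(j < n) P (lam j) v.

Lemma residual_leading n v : (forall j, (j < n)%N -> lam j != 0) ->
  residual (mkseq lam n) (v - leading n v).
Proof.
move=> nz l /lam_mem[i i_n ->] li0.
rewrite linearB linear_sum /= (bigD1 (Ordinal i_n))//= big1 => [|j ji].
  by rewrite addr0 (P_id li0 (P_range li0 v)) subrr.
apply: (P_eigen_orth li0 _ (P_range (nz _ (ltn_ord j)) v)).
apply: contra ji => /eqP/(lam_inj li0 (nz _ (ltn_ord j))) ij.
by apply/eqP/val_inj.
Qed.

Lemma T_residual n v : (forall j, (j < n)%N -> lam j != 0) ->
  T (v - leading n v) = T v - partial_sum lam (fun j => P (lam j)) n v.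
Proof.
move=> nz; rewrite linearB linear_sum; congr (_ - _).
by apply: eq_bigr => j _; rewrite P_range// nz.
Qed.

Lemma residual_iter n v m : residual (mkseq lam n) v ->
  nrm (iter m T v) <= `|lam n| ^+ m * nrm v.
Proof.
move=> vM; suff [] : residual (mkseq lam n) (iter m T v) /\
  nrm (iter m T v) <= `|lam n| ^+ m * nrm v by [].
elim: m => [|m [IHM IHm]]; first by rewrite mul1r.
split; first exact: residual_T.
by rewrite iterS (le_trans (lam_le IHM))// exprS -mulrA ler_wpM2l.
Qed.

Section Infinite.
Hypothesis lam_neq0 : forall n, lam n != 0.

(** Unit eigenvectors for distinct eigenvalues of modulus at least [e] have
    [e]-separated images. *)
Lemma lam_small (e : R) : 0 < e -> exists N, forall n, (N <= n)%N -> `|lam n| < e.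
Proof.
move=> e0; apply: contrapT => big.
have lam_ge n : e <= `|lam n|.
  rewrite leNgt; apply/negP => ne; apply: big; exists n => m nm.
  exact: le_lt_trans (lam_antitone nm) ne.
have /choice[x xP] n := lam_eigen (lam_neq0 n).
apply: (@compact_not_separated _ _ _ compactT x e) => // [n|m n mn].
  by have [_ ->] := xP n.
have [[_ m1 Tm] [_ _ Tn]] := (xP m, xP n).
apply: (le_trans (lam_ge m)); apply: eigen_separated => //.
by rewrite Tn linearZ /= (J_eigen_orth (lam_neq mn (lam_neq0 n)) Tm Tn) mulr0.
Qed.

(** Each spectral projection is contractive: what it removes from [v] consists
    of components in other eigenspaces, annihilated by [J (P v)] as eigenvectors,
    and of a remainder, annihilated by [J_decay]. *)
Lemma P_contractive n v : nrm (P (lam n) v) <= nrm v.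
Proof.
apply: J_orth_le; set x := P (lam n) v.
have Tx : T x = (lam n)%:C *: x by rewrite P_range.
have ln0 : 0 < `|lam n| by rewrite normr_gt0.
have [N NP] := lam_small ln0.
have nN : (n < N)%N by rewrite ltnNge; apply/negP => /NP; rewrite ltxx.
have -> : v - x = (v - leading N v) +
    \sum_(j < N | j != Ordinal nN) P (lam j) v.
  rewrite [leading N v](bigD1 (Ordinal nN))//= opprD addrA -/x.
  by rewrite subrK.
rewrite linearD [X in _ + X]linear_sum [X in _ + X]big1 => [|j jn]; last first.
  have nj : lam n != lam j.
    apply: contra jn => /eqP/(lam_inj (lam_neq0 n) (lam_neq0 j)) nj.
    exact/eqP/val_inj/esym.
  exact: J_eigen_orth nj Tx (P_range (lam_neq0 j) v).
rewrite addr0.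
have := @J_decay 'I_1 predT (fun=> x) (fun=> lam n) (v - leading N v)
  `|lam n| `|lam N|; rewrite big_ord_recl big_ord0 addr0; apply=> //.
- exact: NP.
- by move=> m; apply: residual_iter; apply: residual_leading.
Qed.

(** Where the modulus drops strictly, [J_decay] applies to the whole sum of the
    leading projections. *)
Lemma leading_contractive n v : `|lam n.+1| < `|lam n| ->
  nrm (leading n.+1 v) <= nrm v.
Proof.
move=> gap; apply: J_orth_le.
apply: (J_decay (normr_ge0 (lam n.+1)) gap (l := fun j : 'I__ => lam j)).
- by move=> j _; rewrite P_range.
- by move=> j _; apply: lam_antitone; rewrite -ltnS.
- by move=> m; apply: residual_iter; apply: residual_leading.
Qed.

(** If the modulus does not drop at [n], it does at [n.+1], as at most two real
    numbers share a modulus; the two sums differ by one contraction. *)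
Lemma leading_le n v : nrm (leading n v) <= 2 * nrm v.
Proof.
case: n => [|n]; first by rewrite /leading big_ord0 nrm0 mulr_ge0 ?nrm_ge0.
have := lam_antitone (leqnSn n); rewrite le_eqVlt => /orP[/eqP same|gap].
  have next : `|lam n.+2| < `|lam n.+1|.
    rewrite lt_neqAle lam_antitone// andbT; apply/negP => /eqP same'.
    have opp m k : lam m != lam k -> `|lam m| = `|lam k| -> lam m = - lam k.
      by move=> mk /eqP; rewrite eqr_norm2 (negbTE mk) => /eqP.
    have e1 := opp _ _ (lam_neq (ltnSn n) (lam_neq0 _)) (esym same).
    have e2 := opp _ _ (lam_neq (ltnSn n.+1) (lam_neq0 _)) (esym same').
    have := lam_neq (ltnW (ltnSn n.+1)) (lam_neq0 n.+2).
    by rewrite e1 e2 opprK eqxx.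
  have -> : leading n.+1 v = leading n.+2 v - P (lam n.+1) v.
    by rewrite /leading [in RHS]big_ord_recr /= addrK.
  apply: (le_trans (ler_nrmB _ _)).
  by rewrite mulr2n mulrDl mul1r lerD ?P_contractive ?leading_contractive.
apply: (le_trans (leading_contractive v gap)).
by rewrite ler_peMl ?nrm_ge0// ler1n.
Qed.

(** The constant is [3 = 1 + 2], bounding [v - leading n v] by [leading_le]. *)
Lemma remainder_le n v :
  nrm (T v - partial_sum lam (fun j => P (lam j)) n v) <= 3 * `|lam n| * nrm v.
Proof.
rewrite -T_residual// (le_trans (lam_le (residual_leading _ _)))//.
rewrite mulrAC [leRHS]mulrC ler_wpM2l//.
apply: (le_trans (ler_nrmB _ _)); have := leading_le n v; lra.
Qed.

End Infinite.
End Enumeration.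
End Decomposition.
End SelfAdjoint.

(** * The spectral theorem *)

(** The complement is the kernel of the projection. *)
Lemma kernel_natural_projection (R : realType) (X : normedModType R[i])
    (V : set X) (P : {linear X -> X}) (c : R) :
  finite_dimensional V -> (forall v, nrm (P v) <= c * nrm v) ->
  (forall v, V (P v)) -> (forall v, V v -> P v = v) ->
  natural_projection V P.
Proof.
move=> fdV Pc PV Pid; split=> //; first exact: bounded_continuous Pc.
exists [set v | P v = 0]; split.
- split=> [|a u v]; rewrite !inE /= ?linear0// => Pu Pv.
  by rewrite linearP Pu Pv scaler0 addr0.
- exact: closed_kernel Pc.
- move=> x; exists (P x, x - P x); split=> /=.
    by split=> //; [rewrite linearB (Pid (P x)) ?subrr|rewrite addrC subrK].
  move=> [v w] /= [Vv Pw ->].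
  by rewrite linearD Pw (Pid v)// addr0 addrAC subrr add0r.
- by move=> v w Vv Pw; rewrite linearD Pw (Pid v)// addr0.
Qed.

Theorem theorem2 (R : realType) (X : completeNormedModType R[i])
    (T : {linear X -> X}) :
  smooth X -> continuous T -> compact_operator T -> self_adjoint T ->
  exists (N : option nat) (lambda : nat -> R) (P : nat -> {linear X -> X}),
    [/\ forall n, below N n ->
          lambda n != 0 /\ is_eigenvalue T (lambda n)%:C,
        forall m n, below N m -> below N n -> lambda m = lambda n -> m = n,
        forall n, below N n ->
          natural_projection (ker_sub T (lambda n)%:C) (P n) &
        match N with
        | Some k => (T : X -> X) = partial_sum lambda P k
        | None =>
            (opnorm ((T : X -> X) \- partial_sum lambda P k) @[k --> \oo] --> 0)
            /\ (lambda n @[n --> \oo] --> 0)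
        end].
Proof.
move=> smX contT compactT saT.
have [J [JE J_le J_diag J_unique]] := smooth_duality smX.
have J_adj x v : J x (T v) = J (T x) v.
  have /(congr1 (fun g => g x v)) := saT.
  by rewrite /transpose /= !JE.
have [B B0 T_le] := continuous_bounded contT.
have /choice[P PP] : forall l : R, exists P : {linear X -> X}, l != 0 ->
  [/\ finite_dimensional (ker_sub T l%:C),
      exists c : R, forall v, nrm (P v) <= c * nrm v,
      forall v, T (P v) = l%:C *: P v,
      forall v, T v = l%:C *: v -> P v = v &
      forall v, P (T v) = l%:C *: P v].
  (* At [0] any map will do. *)
  move=> l; have [->|l0] := eqVneq l 0; first by exists T.
  have [Q QP] := spectral_projection J_le J_diag J_unique J_adj compactT l0.
  by exists Q.
have P_fd l : l != 0 -> finite_dimensional (ker_sub T l%:C) by move=> /PP[].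
have P_bd l : l != 0 -> exists c : R, forall v, nrm (P l v) <= c * nrm v.
  by move=> /PP[].
have P_range l : l != 0 -> forall v, T (P l v) = l%:C *: P l v by move=> /PP[].
have P_id l : l != 0 -> forall v, T v = l%:C *: v -> P l v = v by move=> /PP[].
have P_T l : l != 0 -> forall v, P l (T v) = l%:C *: P l v by move=> /PP[].
have [lam lamP] := greedy_eigenvalues_exist J_le J_diag J_unique J_adj compactT
  B0 T_le P_bd P_T.
pose Pn n := P (lam n).
have eig n : lam n != 0 -> lam n != 0 /\ is_eigenvalue T (lam n)%:C.
  by move=> ln0; split=> //; have [x [_ x0 Tx]] := (lamP n).2 ln0; exists x.
have nat_proj n : lam n != 0 ->
    natural_projection (ker_sub T (lam n)%:C) (Pn n).
  move=> ln0; have [c Pc] := P_bd _ ln0.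
  apply: (kernel_natural_projection (P_fd _ ln0) Pc) => v.
    by rewrite /ker_sub /= P_range// subrr.
  by move=> /subr0_eq; exact: P_id.
have inj m n : lam m != 0 -> lam n != 0 -> lam m = lam n -> m = n.
  exact: (lam_inj P_id lamP).
(* The sequence is finite, cut at its first zero, or never vanishes. *)
have [[k0 k0E]|nz] := pselect (exists k, lam k == 0).
  have [k /eqP lk kmin] := find_ex_minn (ex_intro (fun k => lam k == 0) k0 k0E).
  have nz j : (j < k)%N -> lam j != 0.
    by move=> jk; apply: contraTN jk => /kmin; rewrite -leqNgt.
  exists (Some k), lam, Pn; split=> [n /nz/eig//|m n /nz + /nz|n /nz/nat_proj//|].
    exact: inj.
  apply/funext => v; apply/eqP; rewrite -subr_eq0 -nrm_eq0 eq_le nrm_ge0 andbT.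
  rewrite -(T_residual P_range)//.
  have := (lamP k).1 _ (residual_leading P_range P_id P_T lamP v nz).
  by rewrite lk normr0 mul0r.
have {}nz n : lam n != 0 by apply/negP => ln; apply: nz; exists n.
have lam0 : lam n @[n --> \oo] --> 0.
  apply/cvgr0Pnorm_lt => e e0.
  have [N NP] := lam_small J_le J_diag J_unique J_adj compactT P_id lamP nz e0.
  by exists N.
exists None, lam, Pn; split=> [n _|m n _ _|n _|]; [exact: eig|exact: inj|
  exact: nat_proj|split=> //].
have rem := remainder_le J_le J_diag J_unique J_adj compactT P_range P_id P_T
  lamP nz.
have rem0 n : 0 <= 3 * `|lam n| by rewrite mulr_ge0.
apply: (@squeeze_cvgr _ _ _ _ (cst 0) (fun n => 3 * `|lam n|)).
- apply: nearW => n; apply/andP; split.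
    exact: opnorm_ge0 (rem0 n) (rem n).
  exact: opnorm_le (rem0 n) (rem n).
- exact: cvg_cst.
- rewrite -[X in _ --> X](mulr0 3) -[X in _ * X](normr0 R).
  apply: cvgMr; exact: cvg_norm.
Qed.
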